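(* For each $n$, consider the weighted nearest neighbor random walk on the $n$-dimensional hypercube with positive weights $w_i^+,w_i^-$, $1\le i\le n$ (possibly depending on $n$), $\sum_{i=1}^n(w_i^++w_i^-)=1$. Assume that $w_i^+=w_i^-$ for all $i$ and let $w_i=w_i^++w_i^-$. Let $t_*$ be the unique solution to $\sum_{i=1}^ne^{-w_it_*}=\frac12$. If $t_*\min_i\{w_i\}\to\infty$ as $n\to\infty$ and $t_*\min_i\{w_i^2\}$ is bounded over all $n$, then the walk exhibits cutoff (with respect to the separation distance).
   Context: The weighted nearest neighbor random walk on the hypercube $\{+,-\}^n$: at each step, independently, the pair $(i,\epsilon)$ with $1\le i\le n$, $\epsilon\in\{+,-\}$, is chosen with probability $w_i^\epsilon$, and the $i$-th coordinate of the current state is set to $\epsilon$ (other coordinates unchanged). (This is the hyperplane walk on the chambers of the Boolean arrangement $\{x_i=0\}$.) Let $\pi$ be its stationary distribution, $P^t$ its $t$-step transition probabilities, and $s(t)=\max_{x_0}\left(1-\min_{x}\frac{P^t(x_0,x)}{\pi(x)}\right)$ the separation distance for integers $t\ge0$; for real $t\ge 0$, $s(t):=s(\lfloor t\rfloor)$. A sequence of walks (indexed by $n$) exhibits cutoff with respect to the separation distance if there exist times $t_n$ and windows $v_n=o(t_n)$ such that $$\lim_{c\to\infty}\liminf_{n\to\infty}s(t_n-cv_n)=1,\qquad\lim_{c\to\infty}\limsup_{n\to\infty}s(t_n+cv_n)=0.$$ *)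

(* Defs.v *)
From HB Require Import structures.
From mathcomp Require Import all_boot all_order all_algebra.
From mathcomp Require Import all_classical all_reals all_analysis.

Set Implicit Arguments.
Unset Strict Implicit.
Unset Printing Implicit Defensive.

Import Order.TTheory GRing.Theory Num.Theory.
Import numFieldNormedType.Exports.

Local Open Scope classical_set_scope.
Local Open Scope ring_scope.

(* [x0] only witnesses that [T] is nonempty: the value does not depend on it. *)
Definition fin_max (R : realType) (T : finType) (x0 : T) (F : T -> R) : R :=
  \big[Num.max/F x0]_(x : T) F x.

Definition fin_min (R : realType) (T : finType) (x0 : T) (F : T -> R) : R :=
  \big[Num.min/F x0]_(x : T) F x.

(* [true] stands for the sign + and [false] for the sign -. *)
Definition cube (n : nat) : finType := {ffun 'I_n -> bool}.

Definition all_plus (n : nat) : cube n := [ffun=> true].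

Definition set_coord (n : nat) (x : cube n) (i : 'I_n) (e : bool) : cube n :=
  [ffun j => if j == i then e else x j].

Definition trans (R : realType) (n : nat) (w : 'I_n -> bool -> R)
    (x y : cube n) : R :=
  \sum_(i < n) \sum_(e : bool) w i e * (set_coord x i e == y)%:R.

Fixpoint transn (R : realType) (n : nat) (w : 'I_n -> bool -> R) (t : nat)
    (x y : cube n) : R :=
  if t is t'.+1 then \sum_(z : cube n) transn w t' x z * trans w z y
  else (x == y)%:R.

Definition stationary (R : realType) (n : nat) (w : 'I_n -> bool -> R)
    (pi : cube n -> R) : Prop :=
  [/\ forall x, 0 <= pi x,
      \sum_(x : cube n) pi x = 1 &
      forall y, \sum_(x : cube n) pi x * trans w x y = pi y].

Definition separation (R : realType) (n : nat) (w : 'I_n -> bool -> R)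
    (pi : cube n -> R) (t : nat) : R :=
  fin_max (all_plus n) (fun x0 =>
    1 - fin_min (all_plus n) (fun x => transn w t x0 x / pi x)).

(* [Num.truncn t] is the floor of [t] for [0 <= t], and [0] for [t < 0]. *)
Definition separationR (R : realType) (n : nat) (w : 'I_n -> bool -> R)
    (pi : cube n -> R) (t : R) : R :=
  separation w pi (Num.truncn t).

(* [s n] is the distance to stationarity of the n-th walk, as a function of
   real time.  Inferior and superior limits are taken in the extended reals,
   where they always exist. *)
Definition cutoff (R : realType) (s : nat -> R -> R) : Prop :=
  exists t v : nat -> R,
    [/\ (forall n, 0 < t n) /\ (forall n, 0 < v n),
        v =o_\oo t,
        limn_einf (fun n => (s n (t n - c * v n))%:E) @[c --> +oo] --> 1%:E &
        limn_esup (fun n => (s n (t n + c * v n))%:E) @[c --> +oo] --> 0%:E].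

(* Main.v *)
Require Import Defs.
From HB Require Import structures.
From mathcomp Require Import all_boot all_order all_algebra.
From mathcomp Require Import all_classical all_reals all_analysis.
From mathcomp Require Import ring lra.

Set Implicit Arguments.
Unset Strict Implicit.
Unset Printing Implicit Defensive.

Import Order.TTheory GRing.Theory Num.Theory.
Import numFieldNormedType.Exports.

Local Open Scope classical_set_scope.
Local Open Scope ring_scope.

(* Each step refreshes one coordinate to a uniform sign, coordinate [i] with
   probability [w_i]; call this collecting the coupon [i].  Given the set of
   coupons held, the refreshed coordinates are uniform and the others still hold
   their initial value.  The antipode of the starting point is reached only with
   a complete collection, so it is the least likely state, and the separation
   distance at time [t] is the probability that some coupon is still missing.

   Take [t_n = tstar n] and [v_n = 1 / min_i w_i].  The expected number of
   missing coupons is at most [e^(1 - c) / 2] at time [t_n + c v_n], where the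
   union bound applies, and at least of order [e^c] at time [t_n - c v_n], where
   Chebyshev's inequality applies because the events that two given coupons are
   missing are negatively correlated. *)

Section RandomMaps.
Variables (R : numDomainType) (I : finType) (X : Type).
Variables (w : I -> R) (g : I -> X -> X).
Implicit Types (f : X -> R) (x : X) (t : nat) (a : R).

Definition mean f x : R := \sum_i w i * f (g i x).

(* The expectation of [f] at the position reached from [x] by applying [t]
   independent maps [g i], each chosen with probability [w i]. *)
Definition expect t f x : R := iter t mean f x.

Lemma expectS t f x : expect t.+1 f x = mean (expect t f) x.
Proof. by []. Qed.

Lemma expectSr t f x : expect t.+1 f x = expect t (mean f) x.
Proof. by rewrite /expect -iterSr. Qed.

Lemma eq_expect t f f' x : f =1 f' -> expect t f x = expect t f' x.
Proof. by move=> /funext ->. Qed.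

Lemma expect_sum (J : finType) t (F : J -> X -> R) x :
  expect t (fun y => \sum_j F j y) x = \sum_j expect t (F j) x.
Proof.
elim: t x => [//|t IH] x; rewrite expectS /mean.
under eq_bigr do rewrite IH mulr_sumr.
by rewrite exchange_big.
Qed.

Lemma expectZ t a f x : expect t (fun y => a * f y) x = a * expect t f x.
Proof.
elim: t x => [//|t IH] x; rewrite !expectS /mean mulr_sumr.
by apply: eq_bigr => i _; rewrite IH mulrCA.
Qed.

Lemma expectD t f f' x :
  expect t (fun y => f y + f' y) x = expect t f x + expect t f' x.
Proof.
elim: t x => [//|t IH] x; rewrite !expectS /mean -big_split /=.
by apply: eq_bigr => i _; rewrite IH mulrDr.
Qed.

Lemma expect_eigenfun t a f x :
  (forall y, mean f y = a * f y) -> expect t f x = a ^+ t * f x.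
Proof.
move=> fE; elim: t x => [|t IH] x; first by rewrite mul1r.
by rewrite expectSr (eq_expect _ _ fE) expectZ IH mulrA exprS.
Qed.

Hypothesis w_ge0 : forall i, 0 <= w i.
Hypothesis w_sum1 : \sum_i w i = 1.

Lemma expect_cst t a x : expect t (fun=> a) x = a.
Proof.
rewrite (@expect_eigenfun _ 1) ?expr1n ?mul1r // => y.
by rewrite /mean -mulr_suml w_sum1 mul1r.
Qed.

Lemma le_expect t f f' x :
  (forall y, f y <= f' y) -> expect t f x <= expect t f' x.
Proof.
move=> ff'; elim: t x => [//|t IH] x; rewrite !expectS /mean.
by apply: ler_sum => i _; rewrite ler_wpM2l.
Qed.

Lemma weight_le1 i : w i <= 1.
Proof. by rewrite -w_sum1 (bigD1 i) //= lerDl sumr_ge0. Qed.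

End RandomMaps.

(* Chebyshev's inequality: on the event [N = 0], [N] is off its mean [m] by
   exactly [m]. *)
Lemma expect_eq0_chebyshev (R : realDomainType) (I : finType) (X : Type)
    (w : I -> R) (g : I -> X -> X) (t : nat) (N : X -> R) (x : X) :
  (forall i, 0 <= w i) -> \sum_i w i = 1 ->
  expect w g t (fun y => (N y == 0)%:R) x * expect w g t N x ^+ 2 <=
    expect w g t (fun y => N y ^+ 2) x - expect w g t N x ^+ 2.
Proof.
move=> w_ge0 w_sum1; set m := expect w g t N x.
have -> : expect w g t (fun y => N y ^+ 2) x - m ^+ 2 =
    expect w g t (fun y => N y ^+ 2 + (- (2 * m) * N y + m ^+ 2)) x.
  by rewrite !expectD expectZ expect_cst // -/m; ring.
rewrite mulrC -expectZ; apply: le_expect => // y.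
have [->|_] := eqVneq (N y) 0; first by rewrite expr0n mulr0 !add0r mulr1.
rewrite mulr0; have -> : N y ^+ 2 + (- (2 * m) * N y + m ^+ 2) = (N y - m) ^+ 2.
  by ring.
exact: sqr_ge0.
Qed.

Lemma natr_card (R : pzSemiRingType) (I : finType) (A : {set I}) :
  #|A|%:R = \sum_i (i \in A)%:R :> R.
Proof.
rewrite -sum1_card natr_sum big_mkcond; apply: eq_bigr => i _.
by case: (i \in A).
Qed.

Section CouponCollector.
Variables (R : realDomainType) (I : finType) (w : I -> R).
Hypothesis w_ge0 : forall i, 0 <= w i.
Hypothesis w_sum1 : \sum_i w i = 1.

Implicit Types (A S : {set I}) (t : nat).

Definition collect (i : I) S : {set I} := i |: S.

Local Notation E := (expect w collect).

Definition prob_complete t : R :=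
  E t (fun S => (S == [set: I]%SET)%:R) finset.set0.

Definition mean_missing t : R := \sum_i (1 - w i) ^+ t.

Lemma prob_complete_ge0 t : 0 <= prob_complete t.
Proof.
rewrite -(expect_cst collect w_sum1 t 0 finset.set0).
by apply: le_expect => // S; rewrite ler0n.
Qed.

Lemma prob_complete_le1 t : prob_complete t <= 1.
Proof.
rewrite -[leRHS](expect_cst collect w_sum1 t 1 finset.set0).
by apply: le_expect => // S; rewrite lern1 leq_b1.
Qed.

Lemma sum_weight_notin A :
  \sum_(i | i \notin A) w i = 1 - \sum_(i in A) w i.
Proof.
by rewrite -w_sum1 [X in _ = X - _](bigID (mem A)) /= addrAC subrr add0r.
Qed.

Lemma expect_subset_missing t A :
  E t (fun S => (A \subset ~: S)%:R) finset.set0 =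
    (1 - \sum_(i in A) w i) ^+ t.
Proof.
rewrite (expect_eigenfun t (a := 1 - \sum_(i in A) w i)).
  by rewrite finset.setC0 finset.subsetT mulr1.
move=> S; rewrite -sum_weight_notin mulr_suml [RHS]big_mkcond.
apply: eq_bigr => i _.
rewrite finset.setCU finset.subsetI -finset.disjoints_subset disjoint_sym.
rewrite disjoints1.
by case: (i \in A); rewrite ?mulr0.
Qed.

Lemma expect_missing t i :
  E t (fun S => (i \in ~: S)%:R) finset.set0 = (1 - w i) ^+ t.
Proof.
have <- : \sum_(j in [set i]%SET) w j = w i by rewrite big_set1.
rewrite -expect_subset_missing.
by apply: eq_expect => S; rewrite finset.sub1set.
Qed.

Lemma expect_missing2_le t i j : i != j ->
  E t (fun S => (i \in ~: S)%:R * (j \in ~: S)%:R) finset.set0 <=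
    (1 - w i) ^+ t * (1 - w j) ^+ t.
Proof.
move=> ij; have wij : \sum_(k in [set i; j]%SET) w k = w i + w j.
  by rewrite finset.big_setU1 ?big_set1 // inE.
rewrite (eq_expect _ _ t (f' := fun S => ([set i; j]%SET \subset ~: S)%:R)).
  rewrite expect_subset_missing wij -exprMn; apply: lerXn2r; rewrite ?nnegrE.
  - by rewrite -wij -sum_weight_notin sumr_ge0.
  - by rewrite mulr_ge0 // subr_ge0 weight_le1.
  - by have := mulr_ge0 (w_ge0 i) (w_ge0 j); lra.
by move=> S; rewrite finset.subUset !finset.sub1set -natrM mulnb.
Qed.

Lemma expect_card_missing t :
  E t (fun S => #|~: S|%:R) finset.set0 = mean_missing t.
Proof.
rewrite (eq_expect _ _ _ _ (fun S => natr_card R (~: S))) expect_sum.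
by apply: eq_bigr => i _; rewrite expect_missing.
Qed.

Lemma expect_sqr_card_missing_le t :
  E t (fun S => #|~: S|%:R ^+ 2) finset.set0 <=
    mean_missing t + mean_missing t ^+ 2.
Proof.
rewrite (eq_expect _ _ t
  (f' := fun S => \sum_i \sum_j (i \in ~: S)%:R * (j \in ~: S)%:R)); last first.
  move=> S; rewrite natr_card expr2 mulr_suml.
  by apply: eq_bigr => i _; rewrite mulr_sumr.
rewrite expect_sum {1}/mean_missing expr2 mulr_suml -big_split /=.
apply: ler_sum => i _; rewrite expect_sum (bigD1 i) //=; apply: lerD.
  rewrite -expect_missing; apply: le_expect => // S.
  by rewrite -natrM mulnb andbb.
rewrite mulr_sumr [leRHS](bigD1 i) //= -[leLHS]add0r; apply: lerD.
  by rewrite mulr_ge0 // exprn_ge0 // subr_ge0 weight_le1.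
by apply: ler_sum => j ji; rewrite expect_missing2_le // eq_sym.
Qed.

Lemma eq_setT_card_missing S : (S == [set: I]%SET) = (#|~: S| == 0)%N.
Proof. by rewrite cards_eq0 -finset.setCT (inj_eq (can_inj finset.setCK)). Qed.

Lemma prob_incomplete_le t : 1 - prob_complete t <= mean_missing t.
Proof.
rewrite -expect_card_missing lerBlDr -expectD.
rewrite -[leLHS](expect_cst collect w_sum1 t 1 finset.set0).
apply: le_expect => // S; rewrite eq_setT_card_missing -natrD ler1n.
by case: #|_|.
Qed.

Lemma prob_complete_mul_le1 t : prob_complete t * mean_missing t <= 1.
Proof.
have m_ge0 : 0 <= mean_missing t.
  by apply: sumr_ge0 => i _; rewrite exprn_ge0 // subr_ge0 weight_le1.
have [->|m_neq0] := eqVneq (mean_missing t) 0; first by rewrite mulr0.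
have m_gt0 : 0 < mean_missing t by rewrite lt_neqAle eq_sym m_neq0.
rewrite -(ler_pM2r m_gt0) mul1r -mulrA -expr2.
have := expect_eq0_chebyshev collect t (fun S => #|~: S|%:R : R) finset.set0
  w_ge0 w_sum1.
rewrite expect_card_missing (eq_expect _ _ t (f := fun S => (_ == 0)%:R)
  (f' := fun S => (S == [set: I]%SET)%:R)); last first.
  by move=> S; rewrite pnatr_eq0 eq_setT_card_missing.
move=> /le_trans; apply; rewrite lerBlDr; exact: expect_sqr_card_missing_le.
Qed.

End CouponCollector.

Section CompletionLimit.
Variables (R : realType) (I : finType) (w : I -> R).
Hypothesis w_gt0 : forall i, 0 < w i.
Hypothesis w_sum1 : \sum_i w i = 1.

Let w_ge0 i : 0 <= w i := ltW (w_gt0 i).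

Lemma mean_missing_cvg0 : mean_missing w t @[t --> \oo] --> (0 : R).
Proof.
have -> : (0 : R) = \sum_(i : I) 0 by rewrite big1.
apply: cvg_big => [|i _]; first exact: add_continuous.
apply: cvg_expr; have w_le1 := weight_le1 w_ge0 w_sum1 i.
by rewrite ger0_norm ?subr_ge0 // gtrBl.
Qed.

Lemma prob_complete_cvg1 : prob_complete w t @[t --> \oo] --> (1 : R).
Proof.
apply: (@squeeze_cvgr _ _ _ _ (fun t => 1 - mean_missing w t) (fun=> 1)).
- near=> t; rewrite prob_complete_le1 // andbT lerBlDr -lerBlDl.
  exact: prob_incomplete_le.
- rewrite -[X in _ --> X]subr0; apply: cvgB; first exact: cvg_cst.
  exact: mean_missing_cvg0.
- exact: cvg_cst.
Unshelve. all: by end_near. Qed.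

End CompletionLimit.

Section Exponential.
Variable R : realType.
Implicit Types (x w t d : R) (k : nat).

Lemma expRN_le_inv x : 0 < x -> expR (- x) <= x^-1.
Proof.
move=> x_gt0; rewrite expRN lef_pV2 ?posrE ?expR_gt0 //.
by apply: le_trans (expR_ge1Dx x); rewrite lerDr.
Qed.

Lemma expR_le_1B x : x < 1 -> expR (- (x / (1 - x))) <= 1 - x.
Proof.
move=> x_lt1; have x1_gt0 : 0 < 1 - x by rewrite subr_gt0.
rewrite expRN -[leRHS]invrK lef_pV2 ?posrE ?expR_gt0 ?invr_gt0 //.
apply: le_trans (expR_ge1Dx _).
by have -> : 1 + x / (1 - x) = (1 - x)^-1 by field; rewrite gt_eqF.
Qed.

Lemma expR_le_expr1B w t d k : 0 <= w <= 2^-1 -> 0 <= d -> k%:R <= t - d ->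
  expR (- (w * t)) <= expR (2 * w ^+ 2 * t - w * d) * (1 - w) ^+ k.
Proof.
move=> /andP[w_ge0 w_le] d_ge0 k_le.
set q := w / (1 - w).
have w1_gt0 : 0 < 1 - w by lra.
have qB : q - w = w ^+ 2 / (1 - w) by rewrite /q; field; rewrite gt_eqF.
have q_ge : w <= q by rewrite -subr_ge0 qB divr_ge0 ?sqr_ge0 // ltW.
have q_le : q <= w + 2 * w ^+ 2.
  rewrite -lerBlDl qB ler_pdivrMr //.
  by rewrite [_ * w ^+ 2]mulrC -mulrA ler_peMr ?sqr_ge0 //; lra.
have kq : k%:R * q <= (w + 2 * w ^+ 2) * t - w * d.
  have k_ge0 : 0 <= k%:R :> R by [].
  have := ler_wpM2r (le_trans w_ge0 q_ge) k_le.
  have := ler_wpM2r d_ge0 q_ge.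
  have t_ge0 : 0 <= t by lra.
  have := ler_wpM2r t_ge0 q_le; lra.
apply: (@le_trans _ _ (expR (2 * w ^+ 2 * t - w * d) * expR (- q) ^+ k)).
  by rewrite -expRM_natl -expRD ler_expR mulrN; lra.
rewrite ler_wpM2l ?expR_ge0 // lerXn2r ?nnegrE ?expR_ge0 ?(ltW w1_gt0) //.
by apply: expR_le_1B; lra.
Qed.

(* When [4 <= w ^+ 2 * t] the exponential does not approximate
   [(1 - w) ^+ k] well, but it is below [w / 4], and the weights sum to 1. *)
Lemma expR_le_weightD w t d k : 0 < w <= 1 -> 0 <= d -> 16 <= t ->
  k%:R <= t - d ->
  expR (- (w * t)) <= w / 4 + expR (8 - w * d) * (1 - w) ^+ k.
Proof.
move=> /andP[w_gt0 w_le1] d_ge0 t_ge k_le.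
have missing_ge0 : 0 <= (1 - w) ^+ k by rewrite exprn_ge0 // subr_ge0.
have t_gt0 : 0 < t by lra.
have [w2t_ge|w2t_lt] := leP 4 (w ^+ 2 * t).
  rewrite -[leLHS]addr0; apply: lerD; last by rewrite mulr_ge0 ?expR_ge0.
  apply: le_trans (expRN_le_inv (mulr_gt0 w_gt0 t_gt0)) _.
  rewrite -[leRHS]invf_div lef_pV2 ?posrE ?divr_gt0 ?mulr_gt0 //.
  by rewrite ler_pdivrMr // mulrAC -expr2.
have w_le : w <= 2^-1.
  by rewrite leNgt; apply/negP => w_gt; nra.
apply: (le_trans (expR_le_expr1B _ d_ge0 k_le)); first by rewrite ltW.
rewrite -[leLHS]add0r; apply: lerD; first by rewrite divr_ge0 // ltW.
by rewrite ler_wpM2r // ler_expR; lra.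
Qed.

Lemma expRB_cvg0 (a : R) : expR (a - c) @[c --> +oo] --> 0.
Proof.
under eq_fun do rewrite expRD; rewrite -(mulr0 (expR a)).
by apply: cvgM; [exact: cvg_cst|exact: cvgr_expR].
Qed.

End Exponential.

Lemma sum_expR_lt1_gt0 (R : realType) (I : finType) (w : I -> R) (t : R) :
  (forall i, 0 <= w i) -> \sum_i w i = 1 ->
  \sum_i expR (- (w i * t)) < 1 -> 0 < t.
Proof.
move=> w_ge0 w_sum1; apply: contraTT; rewrite -!leNgt -w_sum1 => t_le0.
apply: ler_sum => i _; apply: le_trans (weight_le1 w_ge0 w_sum1 i) _.
by rewrite -expR0 ler_expR oppr_ge0 mulr_ge0_le0.
Qed.

Section CollectionTime.
Variables (R : realType) (I : finType) (w : I -> R) (wmin t c : R).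
Hypothesis wmin_gt0 : 0 < wmin.
Hypothesis wmin_le : forall i, wmin <= w i.
Hypothesis w_sum1 : \sum_i w i = 1.
Hypothesis c_ge0 : 0 <= c.

Let w_gt0 i : 0 < w i := lt_le_trans wmin_gt0 (wmin_le i).
Let w_ge0 i : 0 <= w i := ltW (w_gt0 i).

Lemma weight_window_ge i : c <= w i * (c / wmin).
Proof. by rewrite mulrCA ler_peMr // ler_pdivlMr // mul1r. Qed.

Lemma mean_missing_le k : t + c / wmin <= k.+1%:R ->
  mean_missing w k <= expR (1 - c) * \sum_i expR (- (w i * t)).
Proof.
move=> k_ge; rewrite mulr_sumr; apply: ler_sum => i _.
have w_le1 := weight_le1 w_ge0 w_sum1 i.
apply: (@le_trans _ _ (expR (- w i) ^+ k)).
  by rewrite lerXn2r ?nnegrE ?expR_ge0 ?subr_ge0 // expR_ge1Dx.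
rewrite -expRM_natl -expRD ler_expR.
have := ler_wpM2l (w_ge0 i) k_ge; have := weight_window_ge i.
rewrite -natr1; lra.
Qed.

Lemma mean_missing_ge k : 16 <= t * wmin -> k%:R <= t - c / wmin ->
  \sum_i expR (- (w i * t)) <= 4^-1 + expR (8 - c) * mean_missing w k.
Proof.
move=> twmin_ge k_le.
have <- : \sum_i w i / 4 = 4^-1 by rewrite -mulr_suml w_sum1 mul1r.
rewrite mulr_sumr -big_split /=; apply: ler_sum => i _.
have w_le1 := weight_le1 w_ge0 w_sum1 i.
have window_ge0 : 0 <= c / wmin by rewrite divr_ge0 // ltW.
have w_itv : 0 < w i <= 1 by rewrite w_gt0.
have t_ge0 : 0 <= t by rewrite -(pmulr_lge0 _ wmin_gt0); lra.
have t_ge : 16 <= t.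
  by apply: (le_trans twmin_ge); rewrite ler_piMr // (le_trans (wmin_le i)).
apply: (le_trans (expR_le_weightD w_itv window_ge0 t_ge k_le)).
rewrite lerD2l ler_wpM2r ?exprn_ge0 ?subr_ge0 // ler_expR lerD2l lerN2.
exact: weight_window_ge.
Qed.

Hypothesis tE : \sum_i expR (- (w i * t)) = 2^-1.

Lemma prob_incomplete_after k : t + c / wmin <= k.+1%:R ->
  1 - prob_complete w k <= expR (1 - c).
Proof.
move=> k_ge; apply: (le_trans (prob_incomplete_le w_ge0 w_sum1 k)).
apply: (le_trans (mean_missing_le k_ge)).
by rewrite tE ler_piMr ?expR_ge0 //; lra.
Qed.

Lemma prob_complete_before k : 16 <= t * wmin -> k%:R <= t - c / wmin ->
  prob_complete w k <= 4 * expR (8 - c).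
Proof.
move=> twmin_ge k_le; have := mean_missing_ge twmin_ge k_le; rewrite tE => m_ge.
have p_ge0 := prob_complete_ge0 w_ge0 w_sum1 k.
have mp_le1 := prob_complete_mul_le1 w_ge0 w_sum1 k.
have m_ge4 : 4^-1 <= expR (8 - c) * mean_missing w k by lra.
have := ler_wpM2l p_ge0 m_ge4; have := ler_wpM2l (expR_ge0 (8 - c)) mp_le1.
lra.
Qed.

End CollectionTime.

Lemma stationary_transn (R : realType) (n : nat) (v : 'I_n -> bool -> R)
    (pi : cube n -> R) (t : nat) (y : cube n) :
  stationary v pi -> \sum_x pi x * transn v t x y = pi y.
Proof.
move=> [_ _ pi_trans]; elim: t y => [|t IH] y /=.
  rewrite (bigD1 y) //= eqxx mulr1 big1 ?addr0 // => x xy.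
  by rewrite (negbTE xy) mulr0.
under eq_bigr do rewrite mulr_sumr.
rewrite exchange_big /= -pi_trans; apply: eq_bigr => z _.
by rewrite -IH mulr_suml; apply: eq_bigr => x _; rewrite mulrA.
Qed.

Section SymmetricWalk.
Variables (R : realType) (n : nat) (v : 'I_n -> bool -> R) (w : 'I_n -> R).
Hypothesis v_gt0 : forall i e, 0 < v i e.
Hypothesis v_sym : forall i, v i true = v i false.
Hypothesis wE : forall i, w i = v i true + v i false.
Hypothesis w_sum1 : \sum_i w i = 1.

Implicit Types (S : {set 'I_n}) (x y z : cube n).

Let w_gt0 i : 0 < w i.
Proof. by rewrite wE addr_gt0. Qed.

Let w_ge0 i : 0 <= w i := ltW (w_gt0 i).

Definition antipode x : cube n := [ffun i => ~~ x i].

(* The probability that a walk started at [x] sits at [y], given that exactly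
   the coordinates in [S] have been selected. *)
Definition refreshed x y S : R :=
  \prod_i (if i \in S then 2^-1 else (y i == x i)%:R).

Lemma refreshed_setT x y : refreshed x y [set: 'I_n]%SET = 2^-1 ^+ n.
Proof.
rewrite /refreshed; under eq_bigr do rewrite inE.
by rewrite prodr_const card_ord.
Qed.

Lemma refreshed_set0 x y : refreshed x y finset.set0 = (x == y)%:R.
Proof.
rewrite /refreshed; have [->|xy] := eqVneq x y.
  by rewrite big1 // => i _; rewrite inE eqxx.
have /existsP[i yxi] : [exists i, y i != x i].
  rewrite -negb_forall; apply: contra xy => /forallP yx.
  by apply/eqP/ffunP => i; apply/esym/eqP; exact: yx.
by rewrite (bigD1 i) //= inE (negbTE yxi) mul0r.
Qed.

Lemma refreshed_ge0 x y S : 0 <= refreshed x y S.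
Proof. by apply: prodr_ge0 => i _; case: ifP. Qed.

Lemma refreshed_le1 x y S : refreshed x y S <= 1.
Proof.
apply: prodr_ile1 => i _.
case: ifP => _; last by rewrite ler0n lern1 leq_b1.
by apply/andP; split; lra.
Qed.

Lemma refreshed_antipode x S :
  refreshed x (antipode x) S = 2^-1 ^+ n * (S == [set: 'I_n]%SET)%:R.
Proof.
have [->|] := eqVneq S [set: 'I_n]%SET; first by rewrite refreshed_setT mulr1.
rewrite -finset.subTset => /subsetPn[i _ iS].
rewrite /refreshed (bigD1 i) //= (negbTE iS) ffunE mulr0.
by case: (x i); rewrite mul0r.
Qed.

Lemma sum_set_coord_eq (F : cube n -> R) y i :
  \sum_z F z * \sum_(e : bool) (set_coord z i e == y)%:R =
    \sum_(b : bool) F (set_coord y i b).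
Proof.
have set_coordK z : set_coord z i (y i) = y -> set_coord y i (z i) = z.
  by move=> <-; apply/ffunP => j; rewrite !ffunE; case: eqVneq => // ->.
have set_coord2 b e : set_coord (set_coord y i b) i e = set_coord y i e.
  by apply/ffunP => j; rewrite !ffunE; case: eqVneq.
have set_coord_id : set_coord y i (y i) = y.
  by apply/ffunP => j; rewrite ffunE; case: eqVneq => // ->.
have sum_eq z : \sum_(e : bool) (set_coord z i e == y)%:R =
    (set_coord z i (y i) == y)%:R :> R.
  rewrite (bigD1 (y i)) //= big1 ?addr0 // => e ey; apply/eqP.
  rewrite pnatr_eq0 eqb0; apply: contra ey => /eqP <-.
  by rewrite ffunE eqxx.
under eq_bigr do rewrite sum_eq mulr_natr mulrb.
rewrite -big_mkcond (reindex_onto (set_coord y i) (fun z => z i)) /=.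
  apply: eq_bigl => b.
  by rewrite set_coord2 set_coord_id ffunE !eqxx.
by move=> z /eqP; exact: set_coordK.
Qed.

Lemma sum_refreshed_set_coord x y S i :
  \sum_(b : bool) refreshed x (set_coord y i b) S =
  2 * refreshed x y (i |: S).
Proof.
pose r := \prod_(j | j != i) (if j \in S then 2^-1 else (y j == x j)%:R : R).
have -> : refreshed x y (i |: S) = 2^-1 * r.
  rewrite /refreshed (bigD1 i) //= finset.setU11; congr (_ * _).
  by apply: eq_bigr => j ji; rewrite !inE (negbTE ji).
under eq_bigr => b _.
  rewrite /refreshed (bigD1 i) //= ffunE eqxx.
  under [X in _ * X]eq_bigr => j ji do rewrite ffunE (negbTE ji).
  over.
rewrite -mulr_suml -/r mulrA divff ?pnatr_eq0 //; congr (_ * _).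
rewrite big_bool /=; case: (i \in S); first by lra.
by case: (x i); rewrite ?addr0 ?add0r.
Qed.

Lemma refreshed_intertwines x y S :
  \sum_z refreshed x z S * trans v z y = mean w (@collect _) (refreshed x y) S.
Proof.
have vE i e : v i e = w i / 2 by have := v_sym i; rewrite wE; case: e => ?; lra.
under eq_bigr do rewrite /trans mulr_sumr.
rewrite exchange_big /=; apply: eq_bigr => i _.
transitivity (w i / 2 * \sum_(b : bool) refreshed x (set_coord y i b) S).
  rewrite -(sum_set_coord_eq (fun z => refreshed x z S)) mulr_sumr.
  apply: eq_bigr => z _.
  rewrite mulrCA; congr (_ * _); rewrite mulr_sumr.
  by apply: eq_bigr => e _; rewrite vE.
by rewrite sum_refreshed_set_coord mulrA divfK ?pnatr_eq0.
Qed.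

Lemma transn_expect t x y :
  transn v t x y = expect w (@collect _) t (refreshed x y) finset.set0.
Proof.
elim: t y => [|t IH] y; first exact: (esym (refreshed_set0 x y)).
rewrite expectSr -(eq_expect _ _ _ _ (refreshed_intertwines x y)).
rewrite expect_sum /=; apply: eq_bigr => z _.
by rewrite IH mulrC -expectZ; apply: eq_expect => S; rewrite mulrC.
Qed.

Local Notation p := (prob_complete w).

Lemma transn_ge t x y : 2^-1 ^+ n * p t <= transn v t x y.
Proof.
rewrite transn_expect -expectZ; apply: le_expect => // S.
have [->|_] := eqVneq S [set: 'I_n]%SET; first by rewrite refreshed_setT mulr1.
by rewrite mulr0 refreshed_ge0.
Qed.

Lemma transn_le t x y : transn v t x y <= 2^-1 ^+ n * p t + (1 - p t).
Proof.
have -> : 2^-1 ^+ n * p t + (1 - p t) = 1 + (2^-1 ^+ n - 1) * p t by ring.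
rewrite -[X in X + _](expect_cst (@collect _) w_sum1 t 1 finset.set0).
rewrite -expectZ -expectD transn_expect; apply: le_expect => // S.
have [->|_] := eqVneq S [set: 'I_n]%SET.
  by rewrite refreshed_setT mulr1 addrC subrK.
by rewrite mulr0 addr0 refreshed_le1.
Qed.

Lemma transn_antipode t x : transn v t x (antipode x) = 2^-1 ^+ n * p t.
Proof.
rewrite transn_expect -expectZ.
by apply: eq_expect => S; rewrite refreshed_antipode.
Qed.

Lemma transn_cvg x y : transn v t x y @[t --> \oo] --> (2^-1 ^+ n : R).
Proof.
have lower_cvg : 2^-1 ^+ n * p t @[t --> \oo] --> (2^-1 ^+ n : R).
  rewrite -[X in _ --> X]mulr1; apply: cvgM; first exact: cvg_cst.
  exact: prob_complete_cvg1 w_gt0 w_sum1.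
apply: (squeeze_cvgr _ lower_cvg).
  by near=> t; apply/andP; split; [exact: transn_ge|exact: transn_le].
rewrite -[X in _ --> X]addr0; apply: cvgD; first exact: lower_cvg.
rewrite -(subrr (1 : R)); apply: cvgB; first exact: cvg_cst.
exact: prob_complete_cvg1 w_gt0 w_sum1.
Unshelve. all: by end_near. Qed.

Lemma stationary_uniform pi y : stationary v pi -> pi y = 2^-1 ^+ n.
Proof.
move=> pi_stat; have [_ pi_sum1 _] := pi_stat.
have pi_cvg : \sum_x pi x * transn v t x y @[t --> \oo] -->
    (\sum_x pi x * 2^-1 ^+ n : R).
  apply: cvg_big => [|x _]; first exact: add_continuous.
  by apply: cvgM; [exact: cvg_cst|exact: transn_cvg].
move: pi_cvg; rewrite -mulr_suml pi_sum1 mul1r.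
under eq_fun do rewrite stationary_transn //.
by move=> pi_cvg; apply: (cvg_unique _ _ pi_cvg); [|exact: cvg_cst].
Qed.

Lemma separation_prob_complete pi t : stationary v pi ->
  separation v pi t = 1 - p t.
Proof.
move=> pi_stat; have piE y := stationary_uniform y pi_stat.
have pi_gt0 : 0 < 2^-1 ^+ n :> R by rewrite exprn_gt0.
have minE x : fin_min (all_plus n) (fun y => transn v t x y / pi y) = p t.
  apply/eqP; rewrite eq_le; apply/andP; split.
    apply: (le_trans (bigmin_le _ (antipode x) _)).
    by rewrite transn_antipode piE mulrAC divff ?mul1r // gt_eqF.
  by apply: le_bigmin => [|y _]; rewrite piE ler_pdivlMr // mulrC transn_ge.
rewrite /separation /fin_max minE.
under eq_bigr do rewrite minE.
by elim/big_ind: _ => // a b -> ->; rewrite maxxx.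
Qed.

End SymmetricWalk.

Section LimsupBounds.
Variables (T : choiceType) (X : filteredType T) (R : realType).
Variables (F : set_system X) (FF : Filter F).
Implicit Types (f : X -> \bar R) (l : \bar R).
Local Open Scope ereal_scope.

Lemma limf_esup_le_near f l : (\forall x \near F, f x <= l) ->
  limf_esup f F <= l.
Proof.
move=> fl; apply: (@le_trans _ _ (ereal_sup (f @` [set x | f x <= l]))).
  by apply: ereal_inf_lbound; exists [set x | f x <= l].
by apply: ge_ereal_sup => _ [x /= fxl <-].
Qed.

Lemma limf_einf_ge_near f l : (\forall x \near F, l <= f x) ->
  l <= limf_einf f F.
Proof.
move=> lf; rewrite leeNr; apply: limf_esup_le_near.
by apply: filterS lf => x; rewrite leeN2.
Qed.

End LimsupBounds.

Lemma cutoff_of_bounds (R : realType) (s : nat -> R -> R) (t v : nat -> R)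
    (f g : R -> R) :
  (forall n x, 0 <= s n x <= 1) -> (forall n, 0 < t n) ->
  (forall n, 0 < v n) -> t n / v n @[n --> \oo] --> +oo ->
  f c @[c --> +oo] --> 0 -> g c @[c --> +oo] --> 0 ->
  (\forall c \near +oo, \forall n \near \oo, 1 - f c <= s n (t n - c * v n)) ->
  (\forall c \near +oo, \forall n \near \oo, s n (t n + c * v n) <= g c) ->
  cutoff s.
Proof.
move=> s01 t_gt0 v_gt0 tv_pinfty f0 g0 s_before s_after.
have s_ge0 n x : 0 <= s n x by have /andP[] := s01 n x.
have s_le1 n x : s n x <= 1 by have /andP[] := s01 n x.
exists t, v; split => //.
- apply/eqoP => e e_gt0; near=> n.
  have tv_ge : e^-1 <= t n / v n.
    by near: n; move/cvgryPge : tv_pinfty; exact.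
  by rewrite !gtr0_norm // -ler_pdivrMl // -ler_pdivlMr.
- apply: (@squeeze_cvge _ _ _ _ (fun c => (1 - f c)%:E) _ (fun=> 1%:E)).
  + near=> c; apply/andP; split.
      apply: limf_einf_ge_near; near: c.
      by apply: filterS s_before => c; apply: filterS => n; rewrite lee_fin.
    apply: (le_trans (limn_einf_sup _)); apply: limf_esup_le_near.
    by near=> n; rewrite lee_fin.
  + apply: cvg_EFin; first by near=> c.
    by rewrite -[X in _ --> X]subr0; apply: cvgB; [exact: cvg_cst|].
  + exact: cvg_cst.
- apply: (@squeeze_cvge _ _ _ _ (fun=> 0%:E) _ (EFin \o g)).
  + near=> c; apply/andP; split.
      apply: le_trans (limn_einf_sup _); apply: limf_einf_ge_near.
      by near=> n; rewrite lee_fin.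
    apply: limf_esup_le_near; near: c.
    by apply: filterS s_after => c; apply: filterS => n; rewrite lee_fin.
  + exact: cvg_cst.
  + by apply: cvg_EFin; first by near=> c.
Unshelve. all: by end_near. Qed.

Lemma prob_incomplete_cutoff (R : realType) (I : nat -> finType)
    (w : forall n, I n -> R) (wmin t : nat -> R) :
  (forall n, 0 < wmin n) -> (forall n i, wmin n <= w n i) ->
  (forall n, \sum_i w n i = 1) ->
  (forall n, \sum_i expR (- (w n i * t n)) = 2^-1) ->
  t n * wmin n @[n --> \oo] --> +oo ->
  cutoff (fun n x => 1 - prob_complete (w n) (Num.truncn x)).
Proof.
move=> wmin_gt0 wmin_le w_sum1 tE twmin_pinfty.
have w_ge0 n i : 0 <= w n i by apply: le_trans (wmin_le n i); exact: ltW.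
have twmin_ge a : \forall n \near \oo, a <= t n * wmin n.
  by move/cvgryPge : twmin_pinfty; exact.
apply: (cutoff_of_bounds (t := t) (v := fun n => (wmin n)^-1)
  (f := fun c => 4 * expR (8 - c)) (g := fun c => expR (1 - c))).
- move=> n x; rewrite subr_ge0 prob_complete_le1 //.
  by rewrite lerBlDr lerDl prob_complete_ge0.
- move=> n; apply: (sum_expR_lt1_gt0 (w_ge0 n) (w_sum1 n)).
  by rewrite tE; lra.
- by move=> n; rewrite invr_gt0.
- by under eq_fun do rewrite invrK.
- by rewrite -(mulr0 4); apply: cvgM; [exact: cvg_cst|exact: expRB_cvg0].
- exact: expRB_cvg0.
- near=> c; have c_ge0 : 0 <= c by near: c; exact: nbhs_pinfty_ge.
  near=> n; rewrite lerD2l lerN2.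
  apply: (prob_complete_before (wmin_gt0 n)) => //.
    by near: n; exact: twmin_ge.
  by rewrite truncn_le subr_ge0 ler_pdivrMr //; near: n; exact: twmin_ge.
- near=> c; have c_ge0 : 0 <= c by near: c; exact: nbhs_pinfty_ge.
  near=> n; apply: (prob_incomplete_after (wmin_gt0 n)) => //.
  exact/ltW/truncnS_gt.
Unshelve. all: by end_near. Qed.

(* The n-th walk lives on the cube of dimension n.+1, so that dimensions
   range over the positive integers. *)
Theorem proposition12 (R : realType)
    (wpm : forall n : nat, 'I_n.+1 -> bool -> R)
    (wpm_gt0 : forall n (i : 'I_n.+1) (e : bool), 0 < wpm n i e)
    (wpm_sum1 : forall n, \sum_(i < n.+1) (wpm n i true + wpm n i false) = 1)
    (wpm_sym : forall n (i : 'I_n.+1), wpm n i true = wpm n i false)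
    (w : forall n : nat, 'I_n.+1 -> R)
    (wE : forall n (i : 'I_n.+1), w n i = wpm n i true + wpm n i false)
    (pi : forall n : nat, cube n.+1 -> R)
    (pi_stat : forall n, stationary (wpm n) (pi n))
    (tstar : nat -> R)
    (tstarE : forall n, \sum_(i < n.+1) expR (- (w n i * tstar n)) = 2^-1)
    (tmin_pinfty : tstar n * fin_min ord0 (w n) @[n --> \oo] --> +oo)
    (tmin2_bounded : exists M : R, forall n,
      `|tstar n * fin_min ord0 (fun i => w n i ^+ 2)| <= M) :
  cutoff (fun n => separationR (wpm n) (pi n)).
Proof.
have w_sum1 n : \sum_i w n i = 1.
  by rewrite -[RHS](wpm_sum1 n); apply: eq_bigr => i _.
have w_gt0 n i : 0 < w n i by rewrite wE addr_gt0.
have -> : (fun n => separationR (wpm n) (pi n)) =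
    fun n x => 1 - prob_complete (w n) (Num.truncn x).
  by apply/funext => n; apply/funext => x; exact: separation_prob_complete.
apply: (prob_incomplete_cutoff (wmin := fun n => fin_min ord0 (w n))) => //.
- by move=> n; exact: lt_bigmin.
- by move=> n i; exact: bigmin_le.
Qed.
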